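(* Let $\mathcal L$ be a language over a countable signature, let $I$ be a set and let $\mathfrak M_i$ be an intuitionistic structure for each $i\in I$. If $F$ is a countably incomplete ultrafilter on $I$, then $\prod_{i\in I}^F\mathfrak M_i$ is $\omega$-saturated.
   Context: **Language.** A signature $(\mathrm{Cnst},\mathrm{Pred})$ consists of disjoint sets of constant symbols and predicate symbols (with arities), without function symbols. Fix a denumerable set $\mathrm{Var}$ of variables. Terms are elements of $\mathrm{Var}\cup\mathrm{Cnst}$. $\mathcal L$ is generated by $\varphi::=P(t_1,\dots,t_n)\mid\bot\mid\varphi\wedge\varphi\mid\varphi\vee\varphi\mid\varphi\to\varphi\mid\forall x\,\varphi\mid\exists x\,\varphi$ (no equality). **Intuitionistic structures.** An intuitionistic structure is $\mathfrak M=(W,\le,\{\mathfrak C_w\}_{w\in W})$ with $(W,\le)$ a poset and, for each $w$, $\mathfrak C_w=(D_w,I_w)$ a classical structure for a signature $(\mathrm{Cnst}_w,\mathrm{Pred})$ with $\mathrm{Cnst}_w\subseteq\mathrm{Cnst}$ ($D_w$ nonempty, $I_w(c)\in D_w$ for $c\in\mathrm{Cnst}_w$, $I_w(P)\subseteq D_w^n$ for $n$-ary $P$), such that (1) $w\le w'$ implies $D_w\subseteq D_{w'}$ and $I_w(P)\subseteq I_{w'}(P)$ for all $P$; (2) for each $c\in\mathrm{Cnst}$ there is $c^{\mathfrak M}\in\bigcup_wD_w$ such that for each $w$: if $c^{\mathfrak M}\in D_w$ then $c\in\mathrm{Cnst}_w$ and $I_w(c)=c^{\mathfrak M}$; otherwise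 $c\notin\mathrm{Cnst}_w$ and $I_w(c)$ is undefined. Put $D_{\mathfrak M}=\bigcup_wD_w$. An assignment is a map $\rho:\mathrm{Var}\to D_{\mathfrak M}$, extended to $\rho^{\mathfrak M}$ on terms by $\rho^{\mathfrak M}(c)=c^{\mathfrak M}$; $\rho[x:=d]$ sends $x$ to $d$ and agrees with $\rho$ elsewhere. Satisfaction $\mathfrak M,w\Vdash^\rho\varphi$: $P(t_1,\dots,t_n)$ iff $(\rho^{\mathfrak M}(t_1),\dots,\rho^{\mathfrak M}(t_n))\in I_w(P)$; $\bot$ never; $\wedge,\vee$ pointwise at $w$; $\varphi\to\psi$ iff for all $w'\ge w$, $\mathfrak M,w'\Vdash^\rho\varphi$ implies $\mathfrak M,w'\Vdash^\rho\psi$; $\forall x\,\varphi$ iff for all $w'\ge w$ and $d\in D_{w'}$, $\mathfrak M,w'\Vdash^{\rho[x:=d]}\varphi$; $\exists x\,\varphi$ iff there is $d\in D_w$ with $\mathfrak M,w\Vdash^{\rho[x:=d]}\varphi$. **Filter product.** Let $\mathfrak M_i=(W_i,\le_i,\{(D_{i,w},I_{i,w})\}_{w\in W_i})$ for $i\in I$ and $F$ a filter on $I$. The filter product $\prod_{i\in I}^F\mathfrak M_i=(W,\le,\{(D_{\alpha_F},I_{\alpha_F})\}_{\alpha_F\in W})$ is defined as follows. $W$ is $\prod_{i\in I}W_i$ modulo $\alpha\sim\beta$ iff $\{i\mid\alpha(i)=\beta(i)\}\in F$, the class of $\alpha$ being $\alpha_F$. $\alpha_F\le\beta_F$ iff $\{i\mid\alpha(i)\le_i\beta(i)\}\in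 F$. With $D_i=\bigcup_{w\in W_i}D_{i,w}$, $D$ is $\prod_{i\in I}D_i$ modulo $\xi\approx\eta$ iff $\{i\mid\xi(i)=\eta(i)\}\in F$, with classes $\xi_F$, and $D_{\alpha_F}=\{\xi_F\in D\mid\{i\mid\xi(i)\in D_{i,\alpha(i)}\}\in F\}$. For $c\in\mathrm{Cnst}$ let $\tilde c(i)=c^{\mathfrak M_i}$; $I_{\alpha_F}(c)=\tilde c_F$ if $\tilde c_F\in D_{\alpha_F}$, and undefined otherwise. For $n$-ary $P$, $(\xi^1_F,\dots,\xi^n_F)\in I_{\alpha_F}(P)$ iff $\{i\mid(\xi^1(i),\dots,\xi^n(i))\in I_{i,\alpha(i)}(P)\}\in F$. (This is a well-defined intuitionistic structure with constants interpreted as $\tilde c_F$ and domain $D$.) **Countably incomplete.** An ultrafilter is countably incomplete if it is not closed under countably infinite intersections. **Separation.** A consecution is a pair $\langle\Gamma:\Delta\rangle$ of sets of formulas. A world $w$ and assignment $\rho$ separate it if $\mathfrak M,w\Vdash^\rho\gamma$ for all $\gamma\in\Gamma$ and $\mathfrak M,w\not\Vdash^\rho\delta$ for all $\delta\in\Delta$. It is separable in $U\subseteq W$ if some $w\in U$ and some assignment $\rho$ for $\mathfrak M$ separate it; it is finitely separable in $U$ if $\langle\Gamma':\Delta'\rangle$ is separable in $U$ for all finite $\Gamma'\subseteq\Gamma$, $\Delta'\subseteq\Delta$. A set $\Gamma$ is (finitely) satisfiable in $U$ if $\langle\Gamma:\emptyset\rangle$ is (finitely) separable in $U$. **$\omega$-saturation.**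 For $A\subseteq D_{\mathfrak M}$, $\mathcal L_A$ is the extension of $\mathcal L$ with new constants $\{\underline a\mid a\in A\}$; formulas of $\mathcal L_A$ are evaluated in the expansion of $\mathfrak M$ interpreting each $\underline a$ as $a$. A set $U\subseteq W$ is positively $\omega$-saturated if for all finite $A\subseteq\bigcap_{w\in U}D_w$ and every set $\Gamma(x)\subseteq\mathcal L_A$ of formulas with (at most) the one free variable $x$, if $\Gamma(x)$ is finitely satisfiable in $U$ then it is satisfiable in $U$. $U$ is $\omega$-saturated if for all finite $A\subseteq\bigcap_{w\in U}D_w$ and all sets $\Gamma(x),\Delta(x)\subseteq\mathcal L_A$ of formulas with (at most) the one free variable $x$, if $\langle\Gamma(x):\Delta(x)\rangle$ is finitely separable in $U$ then it is separable in $U$. The structure $\mathfrak M$ is $\omega$-saturated if for every $w\in W$ the set $\{w\}$ is positively $\omega$-saturated and ${\uparrow}w=\{v\in W\mid w\le v\}$ is $\omega$-saturated. *)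

(* Defs.v *)
From HB Require Import structures.
From mathcomp Require Import all_boot all_order.
From mathcomp Require Import boolp classical_sets functions cardinality filter.

Set Implicit Arguments.
Unset Strict Implicit.
Unset Printing Implicit Defensive.

Import Order.TTheory.
Local Open Scope classical_set_scope.
Local Open Scope quotient_scope.

Record signature := Signature {
  Cnst : Type;
  Pred : Type;
  arity : Pred -> nat }.

(* The denumerable set of variables is [nat]. *)
Inductive term (S : signature) :=
  | Var of nat
  | Const of Cnst S.

Inductive formula (S : signature) :=
  | Atom (P : Pred S) of (arity P).-tuple (term S)
  | Bot
  | And of formula S & formula S
  | Or of formula S & formula S
  | Imp of formula S & formula S
  | All of nat & formula S
  | Ex of nat & formula S.

Definition term_vars (S : signature) (t : term S) : set nat :=
  match t with Var x => [set x] | Const _ => set0 end.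

Fixpoint free_vars (S : signature) (phi : formula S) : set nat :=
  match phi with
  | Atom P ts => \bigcup_k term_vars (tnth ts k)
  | Bot => set0
  | And phi psi | Or phi psi | Imp phi psi => free_vars phi `|` free_vars psi
  | All x phi | Ex x phi => free_vars phi `\ x
  end.

(* The union of the domains D_w is presented as a type [univ], of which each
   D_w is a subset; [univ_cover] says that [univ] is no larger than this union,
   and [univ] is thus the set written D_M.  [cint w c] is the partial value
   I_w(c): it is [None] exactly when c is not in Cnst_w. *)
Record istruct (S : signature) := IStruct {
  disp : Order.disp_t;
  world : porderType disp;
  univ : Type;
  dom : world -> set univ;
  cint : world -> Cnst S -> option univ;
  pint : world -> forall P : Pred S, set ((arity P).-tuple univ);
  cst : Cnst S -> univ;
  univ_cover : \bigcup_w dom w = [set: univ];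
  dom_nonempty : forall w, dom w !=set0;
  pint_dom : forall w P ds k, @pint w P ds -> dom w (tnth ds k);
  dom_mono : forall w w', (w <= w')%O -> dom w `<=` dom w';
  pint_mono : forall w w' P, (w <= w')%O -> @pint w P `<=` @pint w' P;
  cint_in : forall w c, dom w (cst c) -> cint w c = Some (cst c);
  cint_out : forall w c, ~ dom w (cst c) -> cint w c = None }.

Arguments pint {S M} w P ds : rename.

Section Semantics.
Variables (S : signature) (M : istruct S).

Definition assignment := nat -> univ M.

Definition upd (rho : assignment) (x : nat) (d : univ M) : assignment :=
  fun y => if y == x then d else rho y.

Definition eval (rho : assignment) (t : term S) : univ M :=
  match t with Var x => rho x | Const c => cst M c end.

Fixpoint sat (w : world M) (rho : assignment) (phi : formula S) : Prop :=
  match phi with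
  | Atom P ts => pint w P (map_tuple (eval rho) ts)
  | Bot => False
  | And phi psi => sat w rho phi /\ sat w rho psi
  | Or phi psi => sat w rho phi \/ sat w rho psi
  | Imp phi psi => forall w', (w <= w')%O -> sat w' rho phi -> sat w' rho psi
  | All x phi => forall w', (w <= w')%O ->
      forall d, dom w' d -> sat w' (upd rho x d) phi
  | Ex x phi => exists2 d, dom w d & sat w (upd rho x d) phi
  end.

Definition separates (w : world M) (rho : assignment)
    (Gamma Delta : set (formula S)) : Prop :=
  (forall phi, Gamma phi -> sat w rho phi) /\
  (forall phi, Delta phi -> ~ sat w rho phi).

Definition separable_in (U : set (world M)) (Gamma Delta : set (formula S)) :=
  exists w rho, U w /\ separates w rho Gamma Delta.

Definition finitely_separable_in (U : set (world M))
    (Gamma Delta : set (formula S)) :=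
  forall Gamma' Delta', finite_set Gamma' -> finite_set Delta' ->
    Gamma' `<=` Gamma -> Delta' `<=` Delta -> separable_in U Gamma' Delta'.

Definition satisfiable_in (U : set (world M)) (Gamma : set (formula S)) :=
  separable_in U Gamma set0.

Definition finitely_satisfiable_in (U : set (world M))
    (Gamma : set (formula S)) :=
  finitely_separable_in U Gamma set0.

End Semantics.

Definition expand_signature (S : signature) (C : Type) : signature :=
  {| Cnst := (Cnst S + C)%type; Pred := Pred S; arity := @arity S |}.

Section Expansion.
Variables (S : signature) (M : istruct S) (A : set (univ M)).

Definition expand_cst (c : Cnst (expand_signature S A)) : univ M :=
  match c with inl c => cst M c | inr a => val a end.

Definition expand_cint (w : world M) (c : Cnst (expand_signature S A)) :=
  match c with
  | inl c => cint w c
  | inr a => if pselect (dom w (val a)) then Some (val a) else None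
  end.

Lemma expand_cint_in w c :
  dom w (expand_cst c) -> expand_cint w c = Some (expand_cst c).
Proof. by case: c => [c|a] /= wc; [exact: cint_in | case: pselect]. Qed.

Lemma expand_cint_out w c : ~ dom w (expand_cst c) -> expand_cint w c = None.
Proof. by case: c => [c|a] /= wc; [exact: cint_out | case: pselect]. Qed.

(* The expansion of M with a constant for each element of A. *)
Definition expansion : istruct (expand_signature S A) :=
  @IStruct (expand_signature S A) (disp M) (world M) (univ M) (@dom S M)
    expand_cint (@pint S M) expand_cst (univ_cover M) (@dom_nonempty S M)
    (@pint_dom S M) (@dom_mono S M) (@pint_mono S M)
    expand_cint_in expand_cint_out.

End Expansion.

Section Saturation.
Variables (S : signature) (M : istruct S).

Definition in_one_var (S' : signature) (x : nat) (Gamma : set (formula S')) :=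
  forall phi, Gamma phi -> free_vars phi `<=` [set x].

Definition positively_omega_saturated_set (U : set (world M)) :=
  forall A : set (univ M), finite_set A -> A `<=` \bigcap_(w in U) dom w ->
  forall (x : nat) (Gamma : set (formula (expand_signature S A))),
    in_one_var x Gamma ->
    @finitely_satisfiable_in _ (expansion A) U Gamma ->
    @satisfiable_in _ (expansion A) U Gamma.

Definition omega_saturated_set (U : set (world M)) :=
  forall A : set (univ M), finite_set A -> A `<=` \bigcap_(w in U) dom w ->
  forall (x : nat) (Gamma Delta : set (formula (expand_signature S A))),
    in_one_var x Gamma -> in_one_var x Delta ->
    @finitely_separable_in _ (expansion A) U Gamma Delta ->
    @separable_in _ (expansion A) U Gamma Delta.

Definition upset (w : world M) : set (world M) := [set v | (w <= v)%O].

Definition omega_saturated :=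
  forall w : world M,
    positively_omega_saturated_set [set w] /\ omega_saturated_set (upset w).

End Saturation.

Section ReducedProduct.
Variables (I : Type) (F : set_system I) (FF : Filter F) (T : I -> Type).

Definition eq_mod (x y : {classic forall i, T i}) : bool :=
  `[< F [set i | x i = y i] >].

Lemma eq_mod_refl : reflexive eq_mod.
Proof. by move=> x; apply/asboolP; apply: filterS filterT. Qed.

Lemma eq_mod_sym : symmetric eq_mod.
Proof. by move=> x y; apply/asboolP/asboolP; apply: filterS => i /= ->. Qed.

Lemma eq_mod_trans : transitive eq_mod.
Proof.
move=> y x z /asboolP xy /asboolP yz; apply/asboolP.
by apply: filterS2 xy yz => i /= -> ->.
Qed.

Canonical eq_mod_equiv := EquivRel eq_mod eq_mod_refl eq_mod_sym eq_mod_trans.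

Definition redprod := {eq_quot eq_mod_equiv}.

Definition cls (x : forall i, T i) : redprod := \pi_redprod x.

Definition rep (a : redprod) : forall i, T i := repr a.

Lemma rep_clsK (a : redprod) : cls (rep a) = a.
Proof. exact: reprK. Qed.

Lemma cls_eq (x y : forall i, T i) : cls x = cls y <-> F [set i | x i = y i].
Proof.
split=> [/eqmodP /asboolP //|xy].
by apply/eqmodP; apply/asboolP.
Qed.

Lemma rep_cls (x : forall i, T i) : F [set i | rep (cls x) i = x i].
Proof. by apply/cls_eq; rewrite rep_clsK. Qed.

End ReducedProduct.

Section FilterProduct.
Variables (S : signature) (I : Type) (F : set_system I) (FF : Filter F).
Variable M : I -> istruct S.

Definition fp_world := redprod FF (fun i => world (M i)).
Definition fp_univ := redprod FF (fun i => univ (M i)).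
HB.instance Definition _ := Choice.on fp_world.

(* Each clause is stated on the representatives chosen by [rep]; the lemmas
   [fp_le_cls], [fp_dom_cls] and [fp_pint_cls] restate it for arbitrary ones. *)
Definition fp_le (a b : fp_world) : bool :=
  `[< F [set i | (rep a i <= rep b i)%O] >].

Definition fp_dom (a : fp_world) : set fp_univ :=
  [set d | F [set i | dom (rep a i) (rep d i)]].

Definition fp_cst (c : Cnst S) : fp_univ := cls FF (fun i => cst (M i) c).

Definition fp_cint (a : fp_world) (c : Cnst S) : option fp_univ :=
  if pselect (fp_dom a (fp_cst c)) then Some (fp_cst c) else None.

Definition fp_pint (a : fp_world) (P : Pred S) :
    set ((arity P).-tuple fp_univ) :=
  [set ds | F [set i |
     pint (rep a i) P (map_tuple (fun d : fp_univ => rep d i) ds)]].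

Arguments fp_pint a P ds : clear implicits.

Lemma fp_le_cls (x y : forall i, world (M i)) :
  fp_le (cls FF x) (cls FF y) <-> F [set i | (x i <= y i)%O].
Proof.
rewrite /fp_le; split=> [/asboolP|] xy; [|apply/asboolP];
  by apply: filterS3 (rep_cls FF x) (rep_cls FF y) xy => i /= -> ->.
Qed.

Lemma fp_dom_cls (x : forall i, world (M i)) (d : forall i, univ (M i)) :
  fp_dom (cls FF x) (cls FF d) <-> F [set i | dom (x i) (d i)].
Proof.
by split=> xd; apply: filterS3 (rep_cls FF x) (rep_cls FF d) xd => i /= -> ->.
Qed.

Lemma filter_forall_ord n (Q : 'I_n -> set I) :
  (forall k, F (Q k)) -> F [set i | forall k, Q k i].
Proof.
elim: n Q => [|n IHn] Q FQ; first by apply: filterS filterT => i _ [].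
have := IHn _ (fun k => FQ (lift ord0 k)).
apply: (filterS2 _ _ (FQ ord0)) => i Q0 Qi k.
by case: (unliftP ord0 k) => [j|] ->.
Qed.

Lemma fp_pint_cls (x : forall i, world (M i)) (P : Pred S)
    (ds : (arity P).-tuple (forall i, univ (M i))) :
  fp_pint (cls FF x) P (map_tuple (@cls _ _ FF _) ds) <->
  F [set i | pint (x i) P (map_tuple (fun d => d i) ds)].
Proof.
have Fds : F [set i | map_tuple (fun d : fp_univ => rep d i)
    (map_tuple (@cls _ _ FF _) ds) = map_tuple (fun d => d i) ds].
  have := filter_forall_ord (fun k => rep_cls FF (tnth ds k)).
  apply: filterS => i eq_i; apply: eq_from_tnth => k.
  by rewrite !tnth_map eq_i.
by split=> xd; apply: filterS3 (rep_cls FF x) Fds xd => i /= -> ->.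
Qed.

Lemma fp_le_refl : reflexive fp_le.
Proof. by move=> a; apply/asboolP; apply: filterS filterT => i /=. Qed.

Lemma fp_le_anti : antisymmetric fp_le.
Proof.
move=> a b /andP[/asboolP ab /asboolP ba].
rewrite -(rep_clsK a) -(rep_clsK b); apply/cls_eq.
by apply: filterS2 ab ba => i /= ab ba; apply/le_anti/andP.
Qed.

Lemma fp_le_trans : transitive fp_le.
Proof.
move=> b a c /asboolP ab /asboolP bc; apply/asboolP.
by apply: filterS2 ab bc => i /=; exact: le_trans.
Qed.

HB.instance Definition _ :=
  Order.Le_isPOrder.Build (Order.Disp tt tt) fp_world
    fp_le_refl fp_le_anti fp_le_trans.

Lemma fp_univ_cover : \bigcup_a fp_dom a = [set: fp_univ].
Proof.
apply/seteqP; split=> // d _.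
have xP i : exists w : world (M i), dom w (rep d i).
  have : [set: univ (M i)] (rep d i) by [].
  by rewrite -univ_cover => -[w _ wd]; exists w.
have [x xd] : exists x : forall i, world (M i), forall i, dom (x i) (rep d i).
  by exists (fun i => sval (cid (xP i))) => i; case: cid.
exists (cls FF x) => //; rewrite -(rep_clsK d); apply/fp_dom_cls.
by apply: filterS filterT => i _; exact: xd.
Qed.

Lemma fp_dom_nonempty a : fp_dom a !=set0.
Proof.
have [d ad] : exists d : forall i, univ (M i), forall i, dom (rep a i) (d i).
  by exists (fun i => sval (cid (dom_nonempty (rep a i)))) => i; case: cid.
exists (cls FF d); rewrite -(rep_clsK a); apply/fp_dom_cls.
by apply: filterS filterT => i _; exact: ad.
Qed.

Lemma fp_pint_dom a P ds k : fp_pint a P ds -> fp_dom a (tnth ds k).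
Proof. by apply: filterS => i /(@pint_dom _ _ _ _ _ k); rewrite tnth_map. Qed.

Lemma fp_dom_mono (a b : fp_world) : (a <= b)%O -> fp_dom a `<=` fp_dom b.
Proof.
move=> /asboolP ab d; apply: filterS2 ab => i /=.
by move=> /dom_mono; exact.
Qed.

Lemma fp_pint_mono (a b : fp_world) P :
  (a <= b)%O -> fp_pint a P `<=` fp_pint b P.
Proof.
move=> /asboolP ab ds; apply: filterS2 ab => i /=.
by move=> /pint_mono; exact.
Qed.

Lemma fp_cint_in a c : fp_dom a (fp_cst c) -> fp_cint a c = Some (fp_cst c).
Proof. by rewrite /fp_cint; case: pselect. Qed.

Lemma fp_cint_out a c : ~ fp_dom a (fp_cst c) -> fp_cint a c = None.
Proof. by rewrite /fp_cint; case: pselect. Qed.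

Definition filter_product : istruct S :=
  @IStruct S (Order.Disp tt tt) fp_world fp_univ fp_dom fp_cint fp_pint fp_cst
    fp_univ_cover fp_dom_nonempty fp_pint_dom fp_dom_mono fp_pint_mono
    fp_cint_in fp_cint_out.

End FilterProduct.

Arguments filter_product {S I} F {FF} M.

Definition countable_signature (S : signature) :=
  countable [set: Cnst S] /\ countable [set: Pred S].

Definition countably_incomplete (I : Type) (F : set_system I) :=
  ~ (forall A : nat -> set I, (forall n, F (A n)) -> F (\bigcap_n A n)).

(* Main.v *)
Require Import Defs.
From mathcomp Require Import all_boot all_order.
From mathcomp Require Import boolp classical_sets functions cardinality filter.

(** The proof follows the classical one for ultraproducts of first-order
structures.

By [los], a formula holds at a world of the ultraproduct exactly when it holds
at the representing worlds of almost all factors.  Negation commutes with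
[F] because [F] is an ultrafilter, so this also applies to formulas that are to
fail ([los_neg]).  Worlds and elements of the ultraproduct are classes of
arbitrary choice functions; hence the clauses that quantify over them, either
elements or later worlds, are handled by choosing a witness in almost every
factor.

Call a set of worlds internal if membership of a class is decided by membership
in a nonempty set [Ui i] in almost every factor.  Both the singleton of a world
and the set of worlds above a world are internal.  Let a consecution over a
countable language be finitely separable in an internal set and let its formulas
be enumerated.  By [los], for each [n] almost every factor has a world in
[Ui i] and an assignment that separate the part of the consecution indexed up
to [n].  Countable incompleteness provides a sequence of sets of [F] whose
intersection is not in [F]; almost every index thus lies outside one of these
sets and has to meet only the requirements before that stage.  A witness for
them is chosen in each factor ([diagonal_choice]), and the class of these
choices separates the whole consecution.  Therefore every internal
set is omega-saturated ([internal_set_omega_saturated]).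

Two choices keep the argument short.  The statement of [los] is about families
of assignments and their classes, and the diagonal argument chooses assignments
of all the variables at once; thus assignments that agree on the free variables
of a formula never have to be compared.  A new constant naming an element of
the ultraproduct is interpreted in each factor by a representative of this
element ([factor]), so that [los] holds directly for the expanded language. *)

Set Implicit Arguments.
Unset Strict Implicit.
Unset Printing Implicit Defensive.

Import Order.TTheory.
Local Open Scope classical_set_scope.

(** * Ultrafilters and choice of witnesses *)

Lemma ultra_setCP (I : Type) (F : set_system I) (FU : UltraFilter F)
    (A : set I) : F (~` A) <-> ~ F A.
Proof.
split=> [FC FA|nFA]; last by case: (in_ultra_setVsetC A FU).
by apply: (filter_not_empty F); rewrite -(setICr A); apply: filterI.
Qed.

(** Total witness function for families in which witnesses exist only almost
everywhere: the inhabitants serve as values at the other indices. *)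
Lemma choice_where_possible (I : Type) (T : I -> Type)
    (Q : forall i, T i -> Prop) :
  (forall i, inhabited (T i)) ->
  exists x : forall i, T i, forall i, (exists t, Q i t) -> Q i (x i).
Proof.
move=> T0; suff H i : exists x : T i, (exists t, Q i t) -> Q i x.
  by exists (fun i => projT1 (cid (H i))) => i; exact: (projT2 (cid (H i))).
have [[t Qt]|nQ] := pselect (exists t, Q i t); first by exists t.
by have [t] := T0 i; exists t.
Qed.

Lemma filter_initial_segment (I : Type) (F : set_system I) {FF : Filter F}
    (E : nat -> set I) n :
  (forall m, F (E m)) -> F [set i | forall m, (m <= n)%N -> E m i].
Proof.
move=> FE; have := @filter_forall _ 'I_n.+1 (fun m => E m) F FF (fun m => FE m).
by apply: filterS => i Ei m mn; have := Ei (Ordinal (mn : (m < n.+1)%N)).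
Qed.

(** The saturation principle behind the theorem, free of logic: requirements
that almost every index can fulfil up to any given stage can all be fulfilled
by one family.  If sets [E n] of [F] have an intersection outside [F], then
almost every [i] lies outside some [E k]; the requirement of number [n] is then
imposed on [x i] only while [i] is in [E 0], ..., [E n], which makes it void for
[n >= k] and leaves finitely many requirements at [i]. *)
Lemma diagonal_choice (I : Type) (F : set_system I) (FU : UltraFilter F)
    (T : I -> Type) (Q : forall i, nat -> T i -> Prop) :
  countably_incomplete F -> (forall i, inhabited (T i)) ->
  (forall n, F [set i | exists t, forall m, (m <= n)%N -> Q i m t]) ->
  exists x : forall i, T i, forall n, F [set i | Q i n (x i)].
Proof.
move=> Finc T0 FQ.
have /existsNP[E /not_implyP[FE nFE]] := Finc.
pose G i n := exists t, forall m, (m <= n)%N -> Q i m t.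
have [x xP] := @choice_where_possible I T (fun i t => forall n,
  (forall m, (m <= n)%N -> E m i) -> G i n -> Q i n t) T0.
exists x => n.
have FnE : F (~` \bigcap_n E n) by apply/ultra_setCP.
apply: filterS3 FnE (filter_initial_segment n FE) (FQ n) => i nE En Gn.
apply: (xP i) En Gn.
have [k nEk] : exists k, ~ E k i.
  by apply/existsNP => Ei; apply: nE => m _; exact: Ei.
(* The witness comes from the largest stage below k that can be reached at i. *)
have [t tP] : exists t, forall n, (n < k)%N -> G i n -> Q i n t.
  elim: k {nEk} => [|k [t tP]]; first by have [t] := T0 i; exists t.
  have [[u uP]|nG] := pselect (G i k).
    by exists u => m mk _; exact: uP.
  exists t => m; rewrite ltnS leq_eqVlt => /orP[/eqP -> //|]; exact: tP.
exists t => m Em; apply: tP; rewrite ltnNge; apply/negP => km.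
exact/nEk/Em.
Qed.

(** * Countability of the language *)

Section CountableFormulas.
Variables (S : signature) (cst_code : Cnst S -> nat) (pred_code : Pred S -> nat).

Definition term_code (t : term S) : nat + nat :=
  match t with Var x => inl x | Const c => inr (cst_code c) end.

(** Reusing labels is harmless: atoms are leaves, a quantified formula is the
only one with a single subtree, and the parity of its label gives the
quantifier. *)
Fixpoint formula_code (phi : formula S) : GenTree.tree (nat * seq (nat + nat)) :=
  match phi with
  | Atom P ts => GenTree.Leaf (pred_code P, map term_code ts)
  | Bot => GenTree.Node 0 [::]
  | And phi psi => GenTree.Node 0 [:: formula_code phi; formula_code psi]
  | Or phi psi => GenTree.Node 1 [:: formula_code phi; formula_code psi]
  | Imp phi psi => GenTree.Node 2 [:: formula_code phi; formula_code psi]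
  | All x phi => GenTree.Node x.*2 [:: formula_code phi]
  | Ex x phi => GenTree.Node x.*2.+1 [:: formula_code phi]
  end.

Hypotheses (cst_inj : injective cst_code) (pred_inj : injective pred_code).

Lemma term_code_inj : injective term_code.
Proof. by move=> [x|c] [y|d] //= [] => [->|/cst_inj ->]. Qed.

Lemma formula_code_inj : injective formula_code.
Proof.
elim=> [P ts||phi IH1 psi IH2|phi IH1 psi IH2|phi IH1 psi IH2|x phi IH|x phi IH]
  [Q us||phi' psi'|phi' psi'|phi' psi'|y phi'|y phi'] //=.
- move=> [/pred_inj PQ]; case: Q / PQ us => us.
  by move=> /(inj_map term_code_inj) /val_inj ->.
- by case=> /IH1 -> /IH2 ->.
- by case=> /IH1 -> /IH2 ->.
- by case=> /IH1 -> /IH2 ->.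
- by case=> /double_inj -> /IH ->.
- by case=> /(congr1 odd); rewrite /= !odd_double.
- by case=> /(congr1 odd); rewrite /= !odd_double.
- by case=> /double_inj -> /IH ->.
Qed.

End CountableFormulas.

Lemma countable_formulas (S : signature) :
  countable_signature S -> countable [set: formula S].
Proof.
move=> [/countable_injP[f fI] /countable_injP[g gI]].
apply/countable_injP; exists (fun phi => pickle (formula_code f g phi)).
move=> phi psi _ _ /(pcan_inj (@pickleK _)); apply: formula_code_inj.
  by move=> x y; apply: fI; rewrite in_setT.
by move=> x y; apply: gI; rewrite in_setT.
Qed.

Lemma countable_expand_signature (S : signature) (U : Type) (A : set U) :
  countable_signature S -> countable A ->
  countable_signature (expand_signature S A).
Proof.
move=> [/countable_injP[f fI] cP] cA; split=> //.
have /countable_injP[g gI] : countable [set: A].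
  by rewrite (eq_countable (card_setT A)).
apply/countable_injP; exists (fun c : Cnst S + A => pickle
  (match c with inl c => inl (f c) | inr a => inr (g a) end : nat + nat)).
move=> [c|a] [d|b] _ _ /(pcan_inj (@pickleK _)) // [].
  by move/fI => -> //; rewrite in_setT.
by move/gI => -> //; rewrite in_setT.
Qed.

(** * Adding constants for arbitrary elements *)

Section WithParams.
Variables (S : signature) (M : istruct S) (C : Type) (k : C -> univ M).

Definition param_cst (c : Cnst (expand_signature S C)) : univ M :=
  match c with inl c => Defs.cst M c | inr a => k a end.

Definition param_cint (w : world M) (c : Cnst (expand_signature S C)) :=
  if pselect (dom w (param_cst c)) then Some (param_cst c) else None.

Lemma param_cint_in w c :
  dom w (param_cst c) -> param_cint w c = Some (param_cst c).
Proof. by rewrite /param_cint; case: pselect. Qed.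

Lemma param_cint_out w c : ~ dom w (param_cst c) -> param_cint w c = None.
Proof. by rewrite /param_cint; case: pselect. Qed.

(** Unlike in [expansion], the new constants need not be elements of the
structure: each factor has to interpret constants that name elements of the
ultraproduct. *)
Definition with_params : istruct (expand_signature S C) :=
  @IStruct (expand_signature S C) (disp M) (world M) (univ M) (@dom S M)
    param_cint (@pint S M) param_cst (univ_cover M) (@dom_nonempty S M)
    (@pint_dom S M) (@dom_mono S M) (@pint_mono S M)
    param_cint_in param_cint_out.

End WithParams.

(** * The theorem of Los for the expanded language *)

Section Los.
Variables (S : signature) (I : Type) (F : set_system I) (FF : Filter F).
Variables (FU : UltraFilter F) (M : I -> istruct S).
Variable A : set (univ (filter_product F M)).

Definition factor (i : I) : istruct (expand_signature S A) :=
  with_params (fun a : A => rep (val a) i).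

Local Notation "<< x >>" := (cls FF x) (format "<< x >>").

Local Notation sat_at i := (@sat _ (factor i)).
Local Notation sat_product := (@sat _ (expansion A)).

Definition cls_assignment (rho : forall i, assignment (M i)) :
  assignment (expansion A) := fun n => << fun i => rho i n >>.

Lemma rep_assignmentK (rho : assignment (expansion A)) :
  cls_assignment (fun i n => rep (rho n) i) = rho.
Proof. by apply/funext => n; exact: rep_clsK. Qed.

Lemma upd_cls rho x (d : forall i, univ (M i)) :
  upd (M := expansion A) (cls_assignment rho) x << d >> =
  cls_assignment (fun i => upd (M := factor i) (rho i) x (d i)).
Proof. by apply/funext => n; rewrite /upd /cls_assignment; case: eqP. Qed.

Lemma eval_cls rho t : eval (M := expansion A) (cls_assignment rho) t =
  << fun i => eval (M := factor i) (rho i) t >>.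
Proof. by case: t => [x|[c|a]] //=; rewrite -[LHS]rep_clsK. Qed.

(** Induction on the formula, for all representatives.  For a disjunction one
uses that [F] is prime.  If an implication or a universal formula fails in
almost every factor, choosing a counterexample in each of them gives a
counterexample in the ultraproduct; an existential formula is similar. *)
Theorem los phi (alpha : forall i, world (M i)) (rho : forall i, assignment (M i)) :
  sat_product << alpha >> (cls_assignment rho) phi <->
  F [set i | sat_at i (alpha i) (rho i) phi].
Proof.
elim: phi alpha rho => [P ts||phi IH1 psi IH2|phi IH1 psi IH2|phi IH1 psi IH2
  |x phi IH|x phi IH] alpha rho /=.
- have -> : map_tuple (eval (M := expansion A) (cls_assignment rho)) ts =
    map_tuple (@cls _ _ FF _)
      (map_tuple (fun t i => eval (M := factor i) (rho i) t) ts).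
    by apply: eq_from_tnth => k; rewrite !tnth_map eval_cls.
  apply: (iff_trans (fp_pint_cls _ _ _)).
  by split; apply: filterS => i /=; congr (pint _ _ _);
    apply: eq_from_tnth => k; rewrite !tnth_map.
- by split=> // /filter_not_empty.
- split=> [[/IH1 + /IH2]|H]; first exact: filterS2.
  by split; [apply/IH1|apply/IH2]; apply: filterS H => i [].
- split=> [[/IH1|/IH2]|H]; [by apply: filterS => i; left
    |by apply: filterS => i; right|].
  have [/IH1|/(ultra_setCP FU) nH] :=
    pselect (F [set i | sat_at i (alpha i) (rho i) phi]); first by left.
  right; apply/IH2.
  by apply: filterS2 H nH => i /= [].
- split=> [H|H w'].
    apply: contrapT => /(ultra_setCP FU) nH.
    have [w wP] := @choice_where_possible I _ (fun i w =>
      [/\ (alpha i <= w)%O, sat_at i w (rho i) phi &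
          ~ sat_at i w (rho i) psi]) (fun i => inhabits (alpha i)).
    have Fw : F [set i | [/\ (alpha i <= w i)%O,
        sat_at i (w i) (rho i) phi & ~ sat_at i (w i) (rho i) psi]].
      apply: filterS nH => i /= /existsNP[v /not_implyP[le_v /not_implyP[sv nsv]]].
      by apply: wP; exists v.
    have : F [set i | sat_at i (w i) (rho i) psi].
      apply/IH2/H; first by apply/fp_le_cls; apply: filterS Fw => i [].
      by apply/IH1; apply: filterS Fw => i [].
    by apply/(ultra_setCP FU); apply: filterS Fw => i [].
  rewrite -(rep_clsK w') => /fp_le_cls le_w /IH1 sphi; apply/IH2.
  by apply: filterS3 H le_w sphi => i /= H /H.
- split=> [H|H w'].
    apply: contrapT => /(ultra_setCP FU) nH.
    have T0 i : inhabited (world (M i) * univ (M i)).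
      by have [d _] := dom_nonempty (alpha i).
    have [wd wdP] := @choice_where_possible I _ (fun i wd =>
      [/\ (alpha i <= wd.1)%O, dom wd.1 wd.2 &
          ~ sat_at i wd.1 (upd (M := factor i) (rho i) x wd.2) phi]) T0.
    have Fw : F [set i | [/\ (alpha i <= (wd i).1)%O, dom (wd i).1 (wd i).2 &
        ~ sat_at i (wd i).1
            (upd (M := factor i) (rho i) x (wd i).2) phi]].
      apply: filterS nH => i /= /existsNP[v /not_implyP[le_v]].
      move=> /existsNP[d /not_implyP[vd nsd]].
      by apply: wdP; exists (v, d).
    have : F [set i | sat_at i (wd i).1
        (upd (M := factor i) (rho i) x (wd i).2) phi].
      apply/IH; rewrite -upd_cls; apply: H.
        by apply/fp_le_cls; apply: filterS Fw => i [].
      by apply/fp_dom_cls; apply: filterS Fw => i [].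
    by apply/(ultra_setCP FU); apply: filterS Fw => i [].
  rewrite -(rep_clsK w') => /fp_le_cls le_w d; rewrite -(rep_clsK d).
  move=> /fp_dom_cls domd; rewrite upd_cls; apply/IH.
  by apply: filterS3 H le_w domd => i /= H /H; apply.
- split=> [[d]|H].
    rewrite -(rep_clsK d) => /fp_dom_cls domd; rewrite upd_cls => /IH.
    by apply: filterS2 domd => i /= domd sd; exists (rep d i).
  have T0 i : inhabited (univ (M i)) by have [d _] := dom_nonempty (alpha i).
  have [d dP] := @choice_where_possible I _ (fun i d => dom (alpha i) d /\
    sat_at i (alpha i) (upd (M := factor i) (rho i) x d) phi) T0.
  have Fd : F [set i | dom (alpha i) (d i) /\
      sat_at i (alpha i) (upd (M := factor i) (rho i) x (d i)) phi].
    by apply: filterS H => i /= [e ae se]; apply: dP; exists e.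
  exists << d >>; first by apply/fp_dom_cls; apply: filterS Fd => i [].
  by rewrite upd_cls; apply/IH; apply: filterS Fd => i [].
Qed.

Corollary los_neg phi (alpha : forall i, world (M i))
    (rho : forall i, assignment (M i)) :
  ~ sat_product << alpha >> (cls_assignment rho) phi <->
  F [set i | ~ sat_at i (alpha i) (rho i) phi].
Proof. by rewrite los -(ultra_setCP FU). Qed.

(** The diagonal argument is applied to pairs of a world and an assignment, the
requirement of number [n] concerning the only formula of code [n], if any. *)
Theorem internal_set_separable (Ui : forall i, set (world (M i)))
    (Gamma Delta : set (formula (expand_signature S A))) :
  (forall i, Ui i !=set0) ->
  countable_signature S -> countably_incomplete F -> countable A ->
  let U := [set a : world (expansion A) | F [set i | Ui i (rep a i)]] in
  finitely_separable_in U Gamma Delta -> separable_in U Gamma Delta.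
Proof.
move=> U0 cS Finc cA U fsep.
have /countable_injP[code code_inj] :=
  countable_formulas (countable_expand_signature cS cA).
have codeI : injective code.
  by move=> phi psi; exact: (code_inj _ _ (in_setT _) (in_setT _)).
pose Q i n (wr : world (M i) * assignment (M i)) := Ui i wr.1 /\
  forall phi, code phi = n ->
    (Gamma phi -> sat_at i wr.1 wr.2 phi) /\
    (Delta phi -> ~ sat_at i wr.1 wr.2 phi).
have T0 i : inhabited (world (M i) * assignment (M i)).
  by have [w _] := U0 i; have [d _] := dom_nonempty w;
    exact: inhabits (w, fun=> d).
have [n|wr wrP] := @diagonal_choice I F FU _ Q Finc T0.
  have fin (H : set (formula (expand_signature S A))) :
      finite_set (H `&` code @^-1` `I_n.+1).
    apply: sub_finite_set (@subIsetr _ _ _) _; apply: finite_preimage.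
      by move=> ? ? _ _; exact: codeI.
    exact: finite_II.
  have [w [r [Uw [sG sD]]]] := fsep _ _ (fin Gamma) (fin Delta)
    (@subIsetl _ _ _) (@subIsetl _ _ _).
  have Fsep m : F [set i | (m <= n)%N -> forall phi, code phi = m ->
      (Gamma phi -> sat_at i (rep w i) (fun k => rep (r k) i) phi) /\
      (Delta phi -> ~ sat_at i (rep w i) (fun k => rep (r k) i) phi)].
    have [[phi phim]|nphi] := pselect (exists phi, code phi = m); last first.
      by apply: filterS filterT => i _ _ phi phim; case: nphi; exists phi.
    have [mn|mn] := boolP (m <= n)%N; last first.
      by apply: filterS filterT => i _ mn'; case/negP: mn.
    have FG : F [set i | Gamma phi ->
        sat_at i (rep w i) (fun k => rep (r k) i) phi].
      have [Gphi|nG] := pselect (Gamma phi); last first.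
        by apply: filterS filterT => i _ /nG.
      have /los : sat_product << rep w >>
          (cls_assignment (fun i k => rep (r k) i)) phi.
        rewrite rep_clsK rep_assignmentK; apply: sG; split=> //.
        by rewrite /= phim.
      by apply: filterS => i /= si _.
    have FD : F [set i | Delta phi ->
        ~ sat_at i (rep w i) (fun k => rep (r k) i) phi].
      have [Dphi|nD] := pselect (Delta phi); last first.
        by apply: filterS filterT => i _ /nD.
      have /los_neg : ~ sat_product << rep w >>
          (cls_assignment (fun i k => rep (r k) i)) phi.
        rewrite rep_clsK rep_assignmentK; apply: sD; split=> //.
        by rewrite /= phim.
      by apply: filterS => i /= si _.
    by apply: filterS2 FG FD => i sGi sDi _ psi; rewrite -phim => /codeI ->.
  apply: filterS2 Uw (filter_initial_segment n Fsep) => i Uwi sepi.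
  exists (rep w i, fun k => rep (r k) i) => m mn; split=> //.
  exact: sepi.
exists << fun i => (wr i).1 >>, (cls_assignment (fun i => (wr i).2)); split.
  by apply: filterS2 (rep_cls FF (fun i => (wr i).1)) (wrP 0%N) => i /= -> [].
split=> phi Hphi; [apply/los|apply/los_neg];
  by apply: filterS (wrP (code phi)) => i [_ /(_ phi erefl)[sG sD]] /=; auto.
Qed.
End Los.

(** * Internal sets of worlds are saturated *)

Lemma omega_saturated_set_positive (S : signature) (M : istruct S)
    (U : set (world M)) :
  omega_saturated_set U -> positively_omega_saturated_set U.
Proof.
move=> satU A finA AU x Gamma Gx fsat.
by apply: (satU A finA AU x Gamma set0 Gx _ fsat) => phi [].
Qed.

Theorem internal_set_omega_saturated (S : signature) (I : Type)
    (F : set_system I) (FF : Filter F) (M : I -> istruct S)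
    (Ui : forall i, set (world (M i))) (FU : UltraFilter F) :
  countable_signature S -> countably_incomplete F -> (forall i, Ui i !=set0) ->
  omega_saturated_set (M := filter_product F M)
    [set a | F [set i | Ui i (rep a i)]].
Proof.
move=> cS Finc U0 A finA _ x Gamma Delta _ _; apply: internal_set_separable => //.
exact: finite_set_countable.
Qed.

Theorem proposition6p4 (S : signature) (I : Type) (M : I -> istruct S)
    (F : set_system I) (FU : UltraFilter F) :
  countable_signature S -> countably_incomplete F ->
  omega_saturated (filter_product F M).
Proof.
move=> cS Finc w; split.
  apply: omega_saturated_set_positive.
  have -> : [set w] = [set a : world (filter_product F M) |
      F [set i | rep w i = rep a i]].
    apply/seteqP; split=> [_ ->|a /= wa]; first by apply: filterS filterT.
    by rewrite -(rep_clsK a) -(rep_clsK w); apply/esym/cls_eq.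
  have U0 i : [set v | rep w i = v] !=set0 by exists (rep w i).
  exact: (internal_set_omega_saturated FU cS Finc U0).
have -> : upset w = [set a : world (filter_product F M) |
    F [set i | (rep w i <= rep a i)%O]].
  by apply/seteqP; split=> a /asboolP.
have U0 i : [set v | (rep w i <= v)%O] !=set0.
  by exists (rep w i); exact: lexx.
exact: (internal_set_omega_saturated FU cS Finc U0).
Qed.
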